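(* Consider a family of well-behaved objects in $\mathbb{R}^2$ such that the union of any $n$ objects of the family has complexity at most $\mathcal{U}(n)$, where $\mathcal{U}(n)/n$ is nondecreasing. Then the intersection graph of any $n$ objects from this family admits a $2$-hop spanner of size $O(\mathcal{U}(n)\log n)$.
   Context: ''Well-behaved'' is the technical regularity condition on families of planar regions from Chekuri, Clarkson and Har-Peled (2012) under which shallow cuttings exist (e.g., disks and pseudodisks are well-behaved); roughly, objects are closed regions bounded by simple closed curves whose boundaries pairwise intersect in a bounded number of points. The union complexity of a set of objects is the number of vertices and edges on the boundary of their union. The intersection graph has the objects as vertices, with an edge iff the two objects intersect. For a graph $G$ and integer $t\ge1$, a $t$-hop spanner is a subgraph $\widehat{G}$ of $G$ on the same vertex set such that for every edge $uv\in E(G)$ there is a $u$–$v$ path in $\widehat{G}$ with at most $t$ edges; its size is its number of edges. *)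

(* Defs.v *)
From HB Require Import structures.
From mathcomp Require Import all_boot all_order all_algebra.
From mathcomp Require Import all_classical all_reals all_analysis.
Set Implicit Arguments. Unset Strict Implicit. Unset Printing Implicit Defensive.
Import Order.TTheory GRing.Theory Num.Theory.
Import numFieldNormedType.Exports.
Local Open Scope classical_set_scope.
Local Open Scope ring_scope.

Notation pt R := (R * R)%type.

Definition bdry (R : realType) (A : set (pt R)) : set (pt R) :=
  closure A `\` interior A.

Definition simple_closed_curve_image (R : realType) (C : set (pt R)) : Prop :=
  exists gamma : R -> pt R,
    {within `[0, 1], continuous gamma} /\
    gamma 0 = gamma 1 /\
    {in `[0, 1[ &, injective gamma} /\
    C = gamma @` `[0, 1].

Definition bounded_pt (R : realType) (A : set (pt R)) : Prop :=
  exists M : R, forall p, A p -> `|p.1| <= M /\ `|p.2| <= M.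

Definition jordan_region (R : realType) (A : set (pt R)) : Prop :=
  closed A /\ bounded_pt A /\ simple_closed_curve_image (bdry A).

Definition well_behaved (R : realType) (s : nat) (F : set (set (pt R))) : Prop :=
  (forall A, F A -> jordan_region A) /\
  (forall A B, F A -> F B -> A <> B ->
     exists l : seq (pt R), (size l <= s)%N /\ bdry A `&` bdry B `<=` [set` l]).

Definition union_of (R : realType) (T : finType) (obj : T -> set (pt R)) : set (pt R) :=
  [set p | exists i, obj i p].

Definition union_vertices (R : realType) (T : finType) (obj : T -> set (pt R)) : set (pt R) :=
  [set p | bdry (union_of obj) p /\
           exists i j, i <> j /\ bdry (obj i) p /\ bdry (obj j) p].

Definition union_edges (R : realType) (T : finType) (obj : T -> set (pt R)) : set (set (pt R)) :=
  let X := bdry (union_of obj) `\` union_vertices obj in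
  [set connected_component X x | x in X].

Definition union_complexity_le (R : realType) (T : finType) (obj : T -> set (pt R)) (k : R) : Prop :=
  exists (V : seq (pt R)) (E : seq (set (pt R))),
    uniq V /\ uniq E /\
    union_vertices obj = [set` V] /\ union_edges obj = [set` E] /\
    ((size V + size E)%:R <= k).

Definition igraph (R : realType) (T : finType) (obj : T -> set (pt R)) (u v : T) : Prop :=
  u <> v /\ obj u `&` obj v !=set0.

Definition t_hop_spanner (T : finType) (G : T -> T -> Prop) (H : rel T) (t : nat) : Prop :=
  (forall u v, H u v -> H v u) /\
  (forall u v, H u v -> G u v) /\
  (forall u v, G u v -> exists p : seq T, (size p <= t)%N /\ path H u p /\ last u p = v).

Definition nedges (T : finType) (H : rel T) : nat :=
  #|([set ([set p.1; p.2])%SET | p in ([set p : T * T | H p.1 p.2])%SET])%SET|.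

(* Main.v *)
(**
Insert the objects one by one. When w is inserted, join it to every later u
that meets w at a point not covered by the objects inserted before w. If u and v
meet at p, the first inserted object containing p is adjacent to (or equal to)
both, so the result is a 2-hop spanner for every insertion order.

For a random order, the expected number of edges created at step r is governed
by the number of pairs {u, w} in a random (r+1)-set Q such that some point is
covered, within Q, by u and w exactly. This number is O(U(|Q|)), and summing
O(n U(r+1) / r^2) over r gives O(U(n) log n).

To bound the pairs, move from such a point along a horizontal ray until the
cover changes. This leads to a point on the boundary of some z in Q covered by
z and a set W of one or two further objects exactly. Then follow the boundary
curve of z until the cover changes again. If an object u of W is lost, a vertex
of the union of S appears for every subfamily S containing z and u and avoiding
the rest of W. If a new object v is entered, the arc just traversed is the end of
an edge of the union of S for every S containing z and v and avoiding W. A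
constant proportion of all S in Q is of this kind, and each vertex or edge is
reached from boundedly many (z, W); averaging the union complexity over S
(Clarkson-Shor) bounds the number of (z, W).
*)

Require Import Defs.
From HB Require Import structures.
From mathcomp Require Import all_boot all_order all_algebra.
From mathcomp Require Import all_classical all_reals all_analysis.
From mathcomp Require Import ring lra zify.
Import Order.TTheory GRing.Theory Num.Theory.
Import numFieldNormedType.Exports.
Local Open Scope ring_scope.

(** * Counting by random subfamilies (Clarkson-Shor) *)

(** Adding [X] to the subsets of [Q :\: (X :|: Z)] is injective and yields only sets of the required
    kind, so these form at least a fraction 2^-c of all subsets of [Q]. *)
Lemma card_between (T : finType) (Q X Z : {set T}) (c : nat) :
  X \subset Q -> [disjoint X & Z] -> (#|X :|: Z| <= c)%N ->
  (2 ^ #|Q| <=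
     2 ^ c * #|[set S : {set T} in powerset Q | (X \subset S) && [disjoint S & Z]]|)%N.
Proof.
move=> XQ dXZ cXZ.
have inj : {in powerset (Q :\: (X :|: Z)) &, injective (fun P => P :|: X)}.
  move=> P1 P2; rewrite !powersetE !finset.subsetD !finset.disjoints_subset.
  move=> /andP[_ P1X] /andP[_ P2X] e; apply/finset.setP => x.
  move/finset.setP/(_ x) : e; rewrite !inE.
  case xX : (x \in X); last by rewrite !orbF.
  move=> _; move/fintype.subsetP: P1X => /(_ x); move/fintype.subsetP: P2X => /(_ x).
  by rewrite !inE xX /=; do 2!case: (x \in _) => //; [move=> /(_ isT) | move=> _ /(_ isT)].
have sub : [set P :|: X | P in powerset (Q :\: (X :|: Z))] \subset
    [set S : {set T} in powerset Q | (X \subset S) && [disjoint S & Z]].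
  apply/fintype.subsetP => _ /imsetP[P + ->]; rewrite powersetE finset.subsetD => /andP[PQ dP].
  rewrite !inE finset.subUset PQ XQ finset.subsetUr /= finset.disjoints_subset finset.subUset.
  rewrite -!finset.disjoints_subset dXZ andbT.
  by apply: disjointWr dP; apply: finset.subsetUr.
apply: leq_trans (leq_mul (leqnn _) (subset_leq_card sub)).
rewrite card_in_imset// card_powerset -expnD leq_exp2l//.
rewrite cardsD; have := subset_leq_card (finset.subsetIr Q (X :|: Z)); lia.
Qed.

(** Double counting of the pairs of [i] and [S] such that some [y] in [L S] is related to [i]: each
    [i] occurs with at least a fraction 2^-c of all [S], and each [S] with at most [d] times [M]
    indices. *)
Lemma charging (R : numDomainType) (T I : finType) (Y : eqType) (Q : {set T})
    (A : {set I}) (L : {set T} -> seq Y) (rel : I -> {set T} -> Y -> bool)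
    (c d : nat) (M : R) :
  (forall i, i \in A -> exists X Z : {set T},
     [/\ X \subset Q, [disjoint X & Z], (#|X :|: Z| <= c)%N &
       forall S : {set T}, S \subset Q -> X \subset S -> [disjoint S & Z] ->
         exists2 y, y \in L S & rel i S y]) ->
  (forall (S : {set T}) y, S \subset Q -> y \in L S ->
     (#|[set i in A | rel i S y]| <= d)%N) ->
  (forall S : {set T}, S \subset Q -> (size (L S))%:R <= M) ->
  #|A|%:R <= (2 ^ c * d)%:R * M.
Proof.
move=> many few LM.
pose N := (\sum_(i in A) \sum_(S in powerset Q) has (rel i S) (L S))%N.
have lo : (2 ^ #|Q| * #|A| <= 2 ^ c * N)%N.
  rewrite mulnC -sum_nat_const big_distrr /=; apply: leq_sum => i iA.
  have [X [Z [XQ dXZ cXZ h]]] := many i iA.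
  apply: (leq_trans (@card_between _ _ _ _ _ XQ dXZ cXZ)).
  rewrite leq_mul2l; apply/orP; right.
  rewrite -sum1_card big_mkcond [leqRHS]big_mkcond; apply: leq_sum => S _.
  rewrite inE; case: ifP => // /andP[SQ /andP[XS dS]]; rewrite SQ.
  suff -> : has (rel i S) (L S) by [].
  by apply/hasP; apply: h => //; rewrite -powersetE.
have hi : (N <= d * \sum_(S in powerset Q) size (L S))%N.
  rewrite /N exchange_big big_distrr /=; apply: leq_sum => S; rewrite powersetE => SQ.
  apply: (@leq_trans (\sum_(y <- L S) \sum_(i in A) rel i S y)%N).
    rewrite exchange_big; apply: leq_sum => i _.
    by elim: (L S) => [|y l IH]; rewrite ?big_nil ?big_cons //=; case: (rel i S y).
  rewrite -sum1_size big_distrr /= big_seq [leqRHS]big_seq; apply: leq_sum => y yL.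
  rewrite muln1; apply: leq_trans (few S y SQ yL).
  by rewrite -sum1_card big_mkcond [leqRHS]big_mkcond; apply: leq_sum => i _;
    rewrite inE; case: (i \in A); case: (rel i S y).
have sumM : (\sum_(S in powerset Q) size (L S))%:R <= (2 ^ #|Q|)%:R * M.
  rewrite natr_sum mulr_natl -card_powerset -sumr_const.
  by apply: ler_sum => S; rewrite powersetE; apply: LM.
have pos : 0 < (2 ^ #|Q|)%:R :> R by rewrite ltr0n expn_gt0.
rewrite -(ler_pM2l pos) -natrM.
apply: (@le_trans _ _ (2 ^ c * (d * \sum_(S in powerset Q) size (L S)))%:R).
  by rewrite ler_nat; apply: leq_trans lo _; rewrite leq_mul2l hi orbT.
rewrite mulrCA mulnA natrM; apply: ler_wpM2l => //.
Qed.

(** * Averaging over insertion orders *)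

(** Deleting the marked element [w] is a bijection between the two kinds of pairs; its inverse
    inserts [w]. *)
Lemma big_card_succ (T : finType) (r : nat) (F : {set T} -> T -> nat) :
  (\sum_(S : {set T} | #|S| == r.+1) \sum_(w in S) F (S :\ w) w =
   \sum_(S : {set T} | #|S| == r) \sum_(w | w \notin S) F S w)%N.
Proof.
rewrite !pair_big_dep /=.
rewrite (reindex_onto (fun p : {set T} * T => (p.2 |: p.1, p.2))
                      (fun p : {set T} * T => (p.1 :\ p.2, p.2))) /=; last first.
  by move=> [S w] /= /andP[_ wS]; rewrite finset.setD1K.
apply: eq_big => [[S w]|[S w]] /=.
  rewrite cardsU1 finset.setU11 andbT xpair_eqE eqxx andbT.
  case wS : (w \in S) => /=.
    rewrite andbF; apply/negbTE; apply/negP => /andP[_ /eqP e].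
    by move/finset.setP/(_ w): e; rewrite wS !inE eqxx.
  by rewrite finset.setU1K ?wS// eqxx !andbT.
by move=> /andP[_ /eqP[e]]; rewrite [in LHS]e.
Qed.

(* A step-by-step minimiser costs at most the average over all insertion orders;
   the induction carries the total cost over all sets of a given size. *)
Lemma greedy_average (R : realFieldType) (T : finType) (good : {set T} -> nat -> Prop)
    (hit : {set T} -> T -> T -> bool) (b : R) :
  0 <= b ->
  good finset.set0 0%N ->
  (forall S k w, good S k -> w \notin S ->
     good (w |: S) (k + #|[set u | (u \notin w |: S) && hit S w u]|)%N) ->
  (forall Q : {set T},
     (\sum_(u in Q) \sum_(w in Q :\ u) hit (Q :\ u :\ w) w u)%:R <= b * #|Q|%:R) ->
  exists k, good finset.setT k /\
    k%:R <= b * #|T|%:R * \sum_(i < #|T|) i.+1%:R^-1.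
Proof.
move=> b0 g0 gS pairs; set n := #|T|.
(* Invariant: over the sets of size [r], the average of [f] is at most [b * n] times the [r]-th
   harmonic number. *)
suff H r : (r <= n)%N -> exists f : {set T} -> nat,
    (forall S : {set T}, #|S| = r -> good S (f S)) /\
    (\sum_(S : {set T} | #|S| == r) f S)%:R <=
      'C(n, r)%:R * (b * n%:R * \sum_(i < r) i.+1%:R^-1).
  have [f [gf]] := H n (leqnn n).
  rewrite binn mul1r => sf; exists (f finset.setT); split;
    first by apply: gf; rewrite finset.cardsT.
  by apply: le_trans sf; rewrite (bigD1 finset.setT) ?finset.cardsT//= ler_nat leq_addr.
elim: r => [_|r IH rn].
  exists (fun=> 0%N); split; first by move=> S /cards0_eq ->.
  by rewrite big1// mulr_ge0 ?mulr_ge0 // big_ord0.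
have [f [gf sf]] := IH (ltnW rn).
pose c (S : {set T}) w := (f S + #|[set u | (u \notin w |: S) && hit S w u]|)%N.
(* The cheapest choice of the last inserted element of [S] costs at most the average over its [r.+1]
   elements. For sets of other sizes 0 is a dummy value. *)
have best (S : {set T}) : exists k : nat, #|S| = r.+1 ->
    good S k /\ (r.+1 * k <= \sum_(w in S) c (S :\ w) w)%N.
  have [Sr|] := eqVneq #|S| r.+1; last by move=> /eqP ne; exists 0%N.
  have [w0 w0S] : exists w, w \in S by apply/finset.set0Pn; rewrite -cards_eq0 Sr.
  case: (@arg_minnP _ w0 (mem S) (fun w => c (S :\ w) w) w0S) => w wS0 wmin.
  have wS : w \in S := wS0.
  exists (c (S :\ w) w) => _; split.
    rewrite -[X in good X _](finset.setD1K wS); apply: gS; last by rewrite !inE eqxx.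
    by apply: gf; have := cardsD1 w S; rewrite wS Sr; lia.
  by rewrite -Sr -sum_nat_const; apply: leq_sum => x xS; apply: wmin.
pose f' (S : {set T}) := projT1 (cid (best S)).
have f'P (S : {set T}) : #|S| = r.+1 ->
    good S (f' S) /\ (r.+1 * f' S <= \sum_(w in S) c (S :\ w) w)%N.
  exact: (projT2 (cid (best S))).
exists f'; split; first by move=> S /f'P[].
(* The edges created when [w] joins a set of size [r] are regrouped by the set of size [r.+2] that
   also contains [w] and the later endpoint [u]. *)
have step : (r.+1 * \sum_(S : {set T} | #|S| == r.+1) f' S <=
    \sum_(S : {set T} | #|S| == r.+2)
       \sum_(u in S) \sum_(w in S :\ u) hit (S :\ u :\ w) w u +
    (n - r) * \sum_(S : {set T} | #|S| == r) f S)%N.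
  apply: (@leq_trans (\sum_(S : {set T} | #|S| == r.+1) \sum_(w in S) c (S :\ w) w)).
    by rewrite big_distrr /=; apply: leq_sum => S /eqP /f'P[].
  rewrite big_card_succ /c.
  under eq_bigr do rewrite big_split /=.
  rewrite big_split /= addnC; apply: leq_add; last first.
    rewrite big_distrr /=; apply: leq_sum => S /eqP Sr.
    rewrite sum_nat_const leq_mul2r; apply/orP; right.
    have <- : #|~: S| = #|[pred w | w \notin S]| by apply: eq_card => x; rewrite !inE.
    have := cardsC S; rewrite /n Sr; lia.
  rewrite (@big_card_succ _ _ (fun Q u => \sum_(w in Q) hit (Q :\ w) w u)%N).
  under [leqRHS]eq_bigr do rewrite exchange_big /=.
  rewrite (eq_bigr (fun S : {set T} => \sum_(w | w \notin S)
     (\sum_(u | u \notin w |: S) hit S w u)))%N; last first.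
    move=> S _; apply: eq_bigr => w wS; rewrite -sum1_card big_mkcond [RHS]big_mkcond.
    by apply: eq_bigr => u _; rewrite inE; case: (u \notin _); case: (hit S w u).
  rewrite -(@big_card_succ _ _ (fun S w => \sum_(u | u \notin w |: S) hit S w u)%N).
  apply: leq_sum => S _; apply: leq_sum => w wS; rewrite finset.setD1K//.
have C1 : (r.+1 * 'C(n, r.+1) = (n - r) * 'C(n, r))%N by rewrite mul_bin_left.
have C2 : (r.+2 * 'C(n, r.+2) = (n - r.+1) * 'C(n, r.+1))%N by rewrite mul_bin_left.
have hits : (\sum_(S : {set T} | #|S| == r.+2)
       \sum_(u in S) \sum_(w in S :\ u) hit (S :\ u :\ w) w u)%:R
    <= b * (r.+2 * 'C(n, r.+2))%:R.
  rewrite natr_sum (@le_trans _ _ (\sum_(S : {set T} | #|S| == r.+2) b * r.+2%:R))//.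
    by apply: ler_sum => S /eqP <-; apply: pairs.
  rewrite sumr_const -[leLHS]mulr_natr natrM mulrA -card_draws.
  suff <- : #|[set A : {set T} | #|A| == r.+2]| = #|[pred A : {set T} | #|A| == r.+2]| by [].
  by apply: eq_card => x; rewrite !inE.
set h := \sum_(i < r) _ in sf; set A := (\sum_(S | _) f S)%N in sf step.
set A' := (\sum_(S | _) f' S)%N in step *.
rewrite big_ord_recr /= -/h.
have {}step : r.+1%:R * A'%:R <= b * (n - r.+1)%:R * 'C(n, r.+1)%:R + (n - r)%:R * A%:R :> R.
  rewrite -!natrM; apply: le_trans (_ : (_ + _)%:R <= _); first by rewrite ler_nat; exact: step.
  by rewrite natrD lerD2r; apply: le_trans hits _; rewrite C2 natrM mulrA.
have r1 : 0 < r.+1%:R :> R by rewrite ltr0n.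
rewrite -(ler_pM2l r1); apply: le_trans step _.
(* The first summand pays for the new edges, as [n - r.+1 <= n]; the second is the inherited cost,
   rewritten by [C1]. *)
have -> : r.+1%:R * ('C(n, r.+1)%:R * (b * n%:R * (h + r.+1%:R^-1))) =
   b * n%:R * 'C(n, r.+1)%:R + (r.+1 * 'C(n, r.+1))%:R * (b * n%:R * h) :> R.
  by rewrite natrM; field; rewrite gt_eqF.
apply: lerD.
  by apply: ler_wpM2r => //; apply: ler_wpM2l => //; rewrite ler_nat leq_subr.
by rewrite C1 natrM -mulrA; apply: ler_wpM2l.
Qed.

(** The inequality ln(1 + x) <= x at x = -1/(i+1) bounds each term after the first by a difference
    of logarithms, so the sum is at most 1 + ln n. The constant 3 comes from 1 <= 2 ln 2 <= 2 ln
    n. *)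
Lemma harmonic_le_ln (R : realType) (n : nat) : (2 <= n)%N ->
  \sum_(i < n) i.+1%:R^-1 <= 3 * ln n%:R :> R.
Proof.
have dln (i : nat) : (0 < i)%N -> i.+1%:R^-1 <= ln i.+1%:R - ln i%:R :> R.
  move=> i0; have i0' : 0 < i%:R :> R by rewrite ltr0n.
  have i1 : 0 < i.+1%:R :> R by rewrite ltr0n.
  have := @le_ln1Dx R (- i.+1%:R^-1).
  have -> : 1 - i.+1%:R^-1 = i%:R / i.+1%:R :> R by rewrite -natr1; field; rewrite natr1 gt_eqF.
  rewrite ln_div// ltrN2 invf_lt1// ltr1n ltnS => /(_ i0).
  move: (ln i%:R) (ln i.+1%:R) (i.+1%:R^-1) => x y z; lra.
case: n => // n n1; suff : \sum_(i < n.+1) i.+1%:R^-1 <= 1 + ln n.+1%:R :> R.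
  have : ln 2%:R <= ln n.+1%:R :> R by rewrite ler_ln ?posrE ?ltr0n// ler_nat.
  have := dln 1%N isT; rewrite ln1; lra.
elim: n {n1} => [|n IH]; first by rewrite big_ord1 ln1 invr1 addr0.
rewrite big_ord_recr /=; move: IH (dln n.+1 isT).
move: (ln n.+1%:R) (ln n.+2%:R) (n.+2%:R^-1) (\sum_(i < n.+1) _) => x y z t; lra.
Qed.

(** * Continuity and connectedness along curves *)

Local Open Scope classical_set_scope.
Local Open Scope ring_scope.

(** Here [c] is the infimum of the failures in [a, b], and the alternative is whether this infimum
    is itself a failure. It serves to follow a ray or a curve until the cover changes. *)
Lemma first_failure (R : realType) (P : R -> Prop) (a b : R) :
  a <= b -> P a -> ~ P b ->
  exists c, [/\ a <= c, c <= b, (forall t, a <= t -> t < c -> P t) &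
    (P c /\ forall d, 0 < d -> exists t, [/\ c < t, t < c + d, t <= b & ~ P t])
    \/ (a < c /\ ~ P c)].
Proof.
move=> ab Pa Pb; pose B := [set t | a <= t <= b /\ ~ P t].
have Bb : B b by split=> //; rewrite ab lexx.
have Blb : has_lbound B by exists a => t [/andP[]].
have Binf : has_inf B by split=> //; exists b.
have aB : a <= inf B by apply: lb_le_inf; [exists b|move=> t [/andP[]]].
have before t : a <= t -> t < inf B -> P t.
  move=> at_ tB; apply: contrapT => nP.
  have tb : t <= b by apply: le_trans (ltW tB) _; apply: ge_inf.
  by move: tB; apply/negP; rewrite -leNgt; apply: ge_inf => //; split=> //; rewrite at_ tb.
exists (inf B); split=> //; first exact: ge_inf.
have [PB|nPB] := pselect (P (inf B)); [left; split=> // d d0|right; split=> //].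
  have [t [/andP[at_ tb] nPt] td] := inf_adherent d0 Binf.
  exists t; split=> //; rewrite lt_neqAle ge_inf ?andbT//.
    by apply/eqP => e; apply: nPt; rewrite -e.
  by split=> //; rewrite at_ tb.
by rewrite lt_neqAle aB andbT; apply/eqP => e; apply: nPB; rewrite -e.
Qed.

(** Within [E] the two closed sets are complementary, so the part of [E] in [K1] is both open and
    closed in [E]. *)
Lemma connected_split (X : topologicalType) (E K1 K2 : set X) (x : X) :
  connected E -> closed K1 -> closed K2 -> E `<=` K1 `|` K2 ->
  E `&` K1 `&` K2 `<=` set0 -> E x -> K1 x -> E `<=` K1.
Proof.
move=> cE cK1 cK2 E12 dis Ex K1x.
suff <- : E `&` K1 = E by move=> y [].
apply: cE; first by exists x.
  exists (~` K2); first exact: closed_openC.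
  apply/seteqP; split=> y [Ey h]; split=> //; first by move=> K2y; apply: (dis y).
  by case: (E12 y Ey).
by exists K1.
Qed.

Lemma curve_near (R : realType) (X : topologicalType) (g : R -> X) (t : R) (B : set X) :
  {within `[0, 1], continuous g} -> 0 <= t <= 1 -> nbhs (g t) B ->
  exists2 d, 0 < d & forall t', 0 <= t' <= 1 -> `|t - t'| < d -> B (g t').
Proof.
move=> /subspace_continuousP cg t01 nB.
have : `[0, 1]%classic t by rewrite /= in_itv.
move=> /cg /(_ B nB); rewrite /= /nbhs /= /within => -[d d0 H].
exists d => // t' t'01 tt'; apply: H => //; by rewrite /= in_itv.
Qed.

(** * Covers and union boundaries of subfamilies *)

Section Arrangement.
Context {R : realType} {T : finType} (obj : T -> set (pt R)).
Implicit Types (S Q W : {set T}) (p q : pt R).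

Definition cover Q p : {set T} := ([set i in Q | `[< obj i p >]])%SET.

(** The union, its vertices and its boundary without vertices are indexed by a set [S] rather than
    by a type, so that many subfamilies can be compared inside one [T]. *)
Definition union_in S : set (pt R) := [set p | exists2 i, i \in S & obj i p].

Definition vertex_in S : set (pt R) :=
  [set p | bdry (union_in S) p /\ exists i j,
     [/\ i \in S, j \in S, i <> j, bdry (obj i) p & bdry (obj j) p]].

Definition arcs_in S : set (pt R) := bdry (union_in S) `\` vertex_in S.

Context (obj_closed : forall i, closed (obj i)).

Lemma coverP Q p i : reflect (i \in Q /\ obj i p) (i \in cover Q p).
Proof. by rewrite inE; apply: (iffP andP) => -[? /asboolP]. Qed.

Lemma bdry_sub i : bdry (obj i) `<=` obj i.
Proof. by move=> p [/obj_closed]. Qed.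

Lemma bdry_closed (A : set (pt R)) : closed (bdry A).
Proof.
have nint : closed (~` A°) by apply: open_closedC; apply: open_interior.
by rewrite /bdry setDE; exact: closedI (@closed_closure _ A) nint.
Qed.

Lemma bdry_limit (A : set (pt R)) p :
  A p -> (forall B, nbhs p B -> exists q, B q /\ ~ A q) -> bdry A p.
Proof.
move=> Ap h; split; first exact: subset_closure.
by move=> /h [q []].
Qed.

(** The objects are closed and finite in number, so a point outside some of them has a neighbourhood
    outside all of these: covers are upper semicontinuous. *)
Lemma cover_near Q p : \forall q \near p, cover Q q \subset cover Q p.
Proof.
have : \forall q \near p, forall i, obj i q -> obj i p.
  apply: (@filter_forall _ T (fun i q => obj i q -> obj i p) (nbhs p) _) => i.
  have [ip|nip] := pselect (obj i p); first by near=> q.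
  have : nbhs p (~` obj i) by apply: open_nbhs_nbhs; split=> //; apply: closed_openC.
  by apply: filterS => q.
apply: filterS => q h; apply/fintype.subsetP => i /coverP[iQ iq].
by apply/coverP; split=> //; apply: h.
Unshelve. all: by end_near. Qed.

(** Near a point covered in [S] by [z] alone the union lies inside [z]. If that point is on the
    boundary of [z], it is not interior to the union, so neither is a limit of such points. *)
Lemma bdry_union_limit S z p :
  z \in S -> obj z p ->
  (forall B, nbhs p B -> exists q, [/\ B q, bdry (obj z) q &
     forall i, i \in S -> obj i q -> i = z]) ->
  bdry (union_in S) p.
Proof.
move=> zS zp h; split; first by apply: subset_closure; exists z.
move=> /nbhs_interior /h[q [qS [_ zq] only]]; apply: zq.
have := cover_near S q; apply: filterS2 qS => x [i iS ix] /fintype.subsetP sub.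
have /sub/coverP[_ iq] : i \in cover S x by apply/coverP.
by rewrite -(only i iS iq).
Qed.

Lemma arcs_in_bdry S p : arcs_in S p -> exists2 i, i \in S & bdry (obj i) p.
Proof.
move=> [[cl nint] _].
have : closed (union_in S).
  rewrite (_ : union_in S = \bigcup_(i in [set` S]) obj i) //.
  by apply: closed_bigcup.
move=> /(_ p cl)[i iS ip]; exists i => //; split; first exact: subset_closure.
by move=> ni; apply: nint; apply: filterS ni => q; exists i.
Qed.

(** The boundary of [z] and the boundaries of the other members are closed and together contain [E];
    a common point on [E] would be a vertex. *)
Lemma arc_on_one_curve S (E : set (pt R)) z p :
  connected E -> E `<=` arcs_in S -> E p -> z \in S -> bdry (obj z) p ->
  E `<=` bdry (obj z).
Proof.
move=> cE EX Ep zS zp.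
apply: (@connected_split _ E _ (\bigcup_(i in [set` (S :\ z)]) bdry (obj i)) p) => //.
- exact: bdry_closed.
- by apply: closed_bigcup => // i _; apply: bdry_closed.
- move=> q /EX/arcs_in_bdry[i iS iq].
  have [<-|iz] := eqVneq i z; first by left.
  by right; exists i => //=; rewrite !inE iz.
- move=> q [[/EX[bq nv] zq] [i /= /setD1P[/eqP iz iS] iq]].
  by apply: nv; split=> //; exists i, z.
Qed.

(** The walk along the curve stops at the first change of cover. If the cover is still right there,
    it shrinks just afterwards and loses some [u]; if it is already wrong, it has gained some [v].
    The first outcome catches the walks that cannot be told apart from ones reaching the end of the
    parametrisation. *)
Lemma curve_walk Q z W (g : R -> pt R) t0 :
  {within `[0, 1], continuous g} ->
  (forall t, 0 <= t <= 1 -> bdry (obj z) (g t)) ->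
  0 <= t0 <= 1 -> cover Q (g t0) = z |: W ->
  [\/ cover Q (g 1) = z |: W,
     exists (t : R) u, [/\ 0 <= t <= 1, u \in W, cover Q (g t) = z |: W &
       forall B, nbhs (g t) B -> exists q,
         [/\ B q, bdry (obj z) q, cover Q q \subset z |: W & u \notin cover Q q]] |
     exists (t1 : R) v, [/\ t0 < t1 <= 1, v \in Q, v \notin z |: W, obj v (g t1) &
       forall t, t0 <= t -> t < t1 -> cover Q (g t) = z |: W]].
Proof.
move=> cg gz /andP[t00 t01] c0.
have [c1|c1] := pselect (cover Q (g 1) = z |: W); first exact: Or31.
have zQ : z \in Q by have : z \in cover Q (g t0) by [rewrite c0 finset.setU11]; move/coverP => [].
have [c [t0c c1' before alt]] :=
  @first_failure _ (fun t => cover Q (g t) = z |: W) _ _ t01 c0 c1.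
have c01 : 0 <= c <= 1 by rewrite c1' (le_trans t00).
case: alt => [[cc near_c]|[ltc cc]]; [apply: Or32|apply: Or33].
  suff [u [uW h]] : exists u, u \in W /\ forall B, nbhs (g c) B -> exists q,
      [/\ B q, bdry (obj z) q, cover Q q \subset z |: W & u \notin cover Q q].
    by exists c, u; split.
  apply: contrapT => no.
  (* If no single [u] is lost arbitrarily near [g c], finiteness gives one neighbourhood in which
     none is lost. *)
  have far : \forall q \near g c, forall u, u \in W -> bdry (obj z) q ->
      cover Q q \subset z |: W -> u \in cover Q q.
    apply: (@filter_forall _ T (fun u q => u \in W -> bdry (obj z) q ->
      cover Q q \subset z |: W -> u \in cover Q q) (nbhs (g c)) _) => u.
    apply: contrapT => nnear; apply: no; exists u.
    have [uW|uW] := boolP (u \in W); last by exfalso; apply: nnear; near=> q; rewrite (negbTE uW).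
    split=> // B nB; apply: contrapT => noq; apply: nnear.
    apply: filterS nB => q Bq _ zq sub; apply: contrapT => /negP uq.
    by apply: noq; exists q.
  have [d d0 H] := curve_near _ _ _ _ _ cg c01 (filterI far (cover_near Q (g c))).
  have [t [ct tcd t1 nt]] := near_c d d0.
  have t01' : 0 <= t <= 1 by rewrite t1 andbT; move: c01 => /andP[c0' _]; lra.
  have [] := H t t01'; first by rewrite distrC gtr0_norm; lra.
  rewrite cc => h sub; apply: nt; apply/eqP; rewrite finset.eqEsubset sub /=.
  apply/fintype.subsetP => u /setU1P[->|uW]; last by apply: h => //; apply: gz.
  by apply/coverP; split=> //; apply: bdry_sub; apply: gz.
(* Parameters just before [c] have cover [z |: W], and covers only shrink near a point, so [g c]
   still has all of it. *)
have zWc : z |: W \subset cover Q (g c).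
  apply/fintype.subsetP => i izW.
  have [//|nic] := boolP (i \in cover Q (g c)).
  have [d d0 H] := curve_near _ _ _ _ _ cg c01 (cover_near Q (g c)).
  pose t := Num.max t0 (c - d / 2).
  have t0t : t0 <= t by rewrite le_max lexx.
  have tc : t < c by rewrite gt_max ltc /=; lra.
  have td : c - d < t by rewrite lt_max; apply/orP; right; lra.
  have t01' : 0 <= t <= 1 by move: c01 => /andP[? ?]; apply/andP; split; lra.
  have := H t t01'; rewrite gtr0_norm ?subr_gt0// => /(_ ltac:(lra)).
  by rewrite before// => /fintype.subsetP/(_ i izW); rewrite (negbTE nic).
have /fintype.subsetPn[v /coverP[vQ vc] vzW] : ~~ (cover Q (g c) \subset z |: W).
  by apply/negP => sub; apply: cc; apply/eqP; rewrite finset.eqEsubset sub.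
by exists c, v; split=> //; rewrite ltc.
Unshelve. all: by end_near. Qed.


(** * Boundary curves and the ends of union edges *)

Context (g : T -> R -> pt R).
Context (g_cont : forall z, {within `[0, 1], continuous (g z)}).
Context (g_loop : forall z, g z 0 = g z 1).
Context (g_inj : forall z, {in `[0, 1[ &, injective (g z)}).
Context (g_image : forall z, bdry (obj z) = g z @` `[0, 1]).

Lemma g_bdry z t : 0 <= t <= 1 -> bdry (obj z) (g z t).
Proof. by move=> t01; rewrite g_image; exists t => //=; rewrite in_itv. Qed.

Lemma curve_piece_closed z (a b : R) : 0 <= a -> b <= 1 -> closed (g z @` `[a, b]).
Proof.
move=> a0 b1; apply: compact_closed; first exact: norm_hausdorff.
apply: continuous_compact; last exact: segment_compact.
apply: continuous_subspaceW (g_cont z).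
by move=> t /=; rewrite !in_itv /= => /andP[at_ tb]; rewrite (le_trans a0 at_) (le_trans tb b1).
Qed.

Lemma curve_eq z s t : 0 <= s <= 1 -> 0 <= t <= 1 -> g z s = g z t ->
  [\/ s = t, s = 0 /\ t = 1 | s = 1 /\ t = 0].
Proof.
move=> /andP[s0 s1] /andP[t0 t1] e.
have H x : 0 <= x -> x < 1 -> x \in `[0, 1[ by move=> *; rewrite in_itv /=; apply/andP.
have [s1'|] := ltP s 1; have [t1'|] := ltP t 1.
- by apply: Or31; apply: (g_inj z); rewrite ?H.
- move=> t1'; have {t1 t1'} t1 : t = 1 by apply/eqP; rewrite eq_le t1 t1'.
  apply: Or32; split=> //; apply: (g_inj z); rewrite ?H//.
  by rewrite e t1 g_loop.
- move=> s1'; have {s1 s1'} s1 : s = 1 by apply/eqP; rewrite eq_le s1 s1'.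
  apply: Or33; split=> //; apply: (g_inj z); rewrite ?H//.
  by rewrite -e s1 g_loop.
- move=> t1' s1'; apply: Or31; apply: le_anti; rewrite (le_trans t1 s1').
  by rewrite (le_trans s1 t1').
Qed.

(* [E] is the edge of the union of [S] whose end, in the direction of the
   parametrisation, is reached from points covered exactly by [z |: W]. *)
Definition edge_end Q S (E : set (pt R)) z W : Prop :=
  [/\ z \in S, z \notin W & exists t0 t1 : R,
   [/\ 0 <= t0, t0 < t1 <= 1,
     forall t, t0 <= t -> t < t1 -> cover Q (g z t) = z |: W /\ arcs_in S (g z t),
     vertex_in S (g z t1) &
     E = connected_component (arcs_in S) (g z t0)]].

(** An edge lies on a single boundary curve, which determines [z]. It has a single end in the
    direction of the parametrisation, and the cover just before that end determines [W]. *)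
Lemma edge_end_unique Q S E z W z' W' :
  edge_end Q S E z W -> edge_end Q S E z' W' -> z = z' /\ W = W'.
Proof.
move=> [zS zW [t0 [t1 [t00 /andP[t01 t11] arc vx eE]]]].
move=> [zS' zW' [t0' [t1' [t00' /andP[t01' t11'] arc' vx' eE']]]].
have cE : connected E by rewrite eE; apply: component_connected.
have EX : E `<=` arcs_in S by rewrite eE; apply: connected_component_sub.
have Et0 : E (g z t0).
  by rewrite eE; apply: connected_component_refl; have [] := arc t0 (lexx _) t01.
have Et0' : E (g z' t0').
  by rewrite eE'; apply: connected_component_refl; have [] := arc' t0' (lexx _) t01'.
have I0 : 0 <= t0 <= 1 by rewrite t00 (ltW (lt_le_trans t01 t11)).
have I0' : 0 <= t0' <= 1 by rewrite t00' (ltW (lt_le_trans t01' t11')).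
have zz' : z = z'.
  apply: contrapT => ne; have [bU nv] := EX _ Et0'; apply: nv; split=> //.
  exists z, z'; split=> //; last exact: g_bdry.
  exact: (arc_on_one_curve _ _ _ _ cE EX Et0 zS (g_bdry _ _ I0)).
subst z'; split=> //.
(* Two distinct end vertices cut the closed curve into the arcs [K1] and [K2], the latter passing
   through the base point. The edge would have a point in each without containing either vertex,
   contradicting connectedness. *)
have apart (s0 s1 s0' s1' : R) : 0 <= s0 -> s0 < s1 -> 0 <= s0' -> s0' < s1' -> s1' <= 1 ->
    (forall t, s0' <= t -> t < s1' -> arcs_in S (g z t)) ->
    vertex_in S (g z s1) -> vertex_in S (g z s1') ->
    E (g z s0) -> E (g z s0') -> ~ s1 < s1'.
  move=> s00 s01 s00' s01' s11' arcs v v' Es Es' s11.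
  have late : s1 < s0'.
    by rewrite ltNge; apply/negP => s0's1; have [_] := arcs s1 s0's1 s11.
  pose K1 := g z @` `[s1, s1']; pose K2 := g z @` `[0, s1] `|` g z @` `[s1', 1].
  have K12 p : K1 p -> K2 p -> p = g z s1 \/ p = g z s1'.
    move=> [a /=]; rewrite in_itv /= => /andP[a1 a2] <-.
    have Ia : 0 <= a <= 1 by apply/andP; split; lra.
    move=> [] [b /=]; rewrite in_itv /= => /andP[b1 b2] ba.
      have Ib : 0 <= b <= 1 by apply/andP; split; lra.
      have [e|[e1 e2]|[e1 e2]] := curve_eq z b a Ib Ia ba.
      - by left; congr g; lra.
      - by right; congr g; lra.
      - by left; congr g; lra.
    have Ib : 0 <= b <= 1 by apply/andP; split; lra.
    have [e|[e1 e2]|[e1 e2]] := curve_eq z b a Ib Ia ba.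
    - by right; congr g; lra.
    - by right; congr g; lra.
    - by left; congr g; lra.
  have dis : E `&` K1 `&` K2 `<=` set0.
    by move=> p [[/EX[_ nv] k1] k2]; case: (K12 p k1 k2) => pe; apply: nv; rewrite pe.
  have EK : E `<=` K1.
    apply: (@connected_split _ E K1 K2 (g z s0')) => //.
    - by apply: curve_piece_closed; lra.
    - by apply: closedU; apply: curve_piece_closed; lra.
    - move=> p Ep; have := arc_on_one_curve _ _ _ _ cE EX Et0 zS (g_bdry _ _ I0) p Ep.
      rewrite g_image => -[a /=]; rewrite in_itv /= => /andP[a0 a1] <-.
      have [h|h] := leP a s1; first by right; left; exists a => //=; rewrite in_itv /= a0.
      have [h'|h'] := leP a s1'; first by left; exists a => //=; rewrite in_itv /= h' ltW.
      by right; right; exists a => //=; rewrite in_itv /= a1 ltW.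
    - by exists s0' => //=; rewrite in_itv /= !ltW.
  apply: (dis (g z s0)); split; first by split=> //; apply: EK.
  by left; exists s0 => //=; rewrite in_itv /= s00 ltW.
have t11e : t1 = t1'.
  apply: le_anti; apply/andP; split; rewrite leNgt; apply/negP.
    by apply: (apart t0' t1' t0 t1) => // t h1 h2; have [] := arc t h1 h2.
  by apply: (apart t0 t1 t0' t1') => // t h1 h2; have [] := arc' t h1 h2.
(* Both traversed arcs now end at [t1], so the later of their starting parameters belongs to
   both. *)
subst t1'; pose t := Num.max t0 t0'.
have [c _] : cover Q (g z t) = z |: W /\ arcs_in S (g z t).
  by apply: arc; [rewrite le_max lexx | rewrite gt_max t01].
have [c' _] : cover Q (g z t) = z |: W' /\ arcs_in S (g z t).
  by apply: arc'; [rewrite le_max lexx orbT | rewrite gt_max t01].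
by rewrite -(finset.setU1K zW) -(finset.setU1K zW') -c -c'.
Qed.


(** * Bounding the boundary pairs *)

(** [W] has one element when a ray stops on one of its two original objects, and two when it enters
    a third. *)
Definition boundary_pairs Q : {set T * {set T}} :=
  ([set x : T * {set T} | [&& x.1 \notin x.2, (0 < #|x.2| <= 2)%N &
     `[< exists p, bdry (obj x.1) p /\ cover Q p = x.1 |: x.2 >]]])%SET.

Lemma boundary_pairs_bound Q (M : R) :
  (forall S, S \subset Q -> exists (V : seq (pt R)) (E : seq (set (pt R))),
     [/\ vertex_in S `<=` [set` V],
        forall p, arcs_in S p -> connected_component (arcs_in S) p \in E &
        (size V + size E)%:R <= M]) ->
  #|boundary_pairs Q|%:R <= #|Q|%:R + 40 * M.
Proof.
move=> cplx.
(* Vertex and edge lists are fixed for all [S] at once, with empty lists as dummies outside [Q]. *)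
have /choice[VE' VEP] : forall S, exists L : seq (pt R) * seq (set (pt R)),
    S \subset Q -> [/\ vertex_in S `<=` [set` L.1],
      forall p, arcs_in S p -> connected_component (arcs_in S) p \in L.2 &
      (size L.1 + size L.2)%:R <= M].
  move=> S; have [SQ|nSQ] := boolP (S \subset Q); last by exists ([::], [::]).
  by have [V [E h]] := cplx S SQ; exists (V, E).
pose V S := (VE' S).1; pose E S := (VE' S).2.
have VE S : S \subset Q -> [/\ vertex_in S `<=` [set` V S],
    forall p, arcs_in S p -> connected_component (arcs_in S) p \in E S &
    (size (V S) + size (E S))%:R <= M] by exact: VEP.
pose A := boundary_pairs Q.
(* [A0], [A1] and [A2] collect the pairs for which [curve_walk] has its first, second and third
   outcome. *)
pose A0 := ([set x : T * {set T} in A | cover Q (g x.1 1) == x.1 |: x.2])%SET.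
pose A1 := ([set x : T * {set T} in A | `[< exists (t : R) u, [/\ 0 <= t <= 1, u \in x.2,
  cover Q (g x.1 t) = x.1 |: x.2 & forall B, nbhs (g x.1 t) B -> exists q,
    [/\ B q, bdry (obj x.1) q, cover Q q \subset x.1 |: x.2 & u \notin cover Q q]] >]])%SET.
pose A2 := ([set x : T * {set T} in A | `[< exists (t0 t1 : R) v, [/\ 0 <= t0, t0 < t1 <= 1,
  v \in Q, v \notin x.1 |: x.2 & obj v (g x.1 t1) /\
  forall t, t0 <= t -> t < t1 -> cover Q (g x.1 t) = x.1 |: x.2] >]])%SET.
have A012 : (#|A| <= #|A0| + #|A1| + #|A2|)%N.
  apply: (@leq_trans #|A0 :|: A1 :|: A2|).
    apply: subset_leq_card; apply/fintype.subsetP => -[z W] xA.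
    have := xA; rewrite inE /= => /and3P[_ _ /asboolP[p [zp cp]]].
    move: zp; rewrite g_image => -[t0 /=]; rewrite in_itv /= => t01 gt.
    rewrite 2!inE ![_ \in A0]inE ![_ \in A1]inE ![_ \in A2]inE xA /=.
    move: cp; rewrite -gt => cp.
    have [->|h|[t1 [v [/andP[t01' t11] vQ vzW vt before]]]] :=
      curve_walk _ _ _ _ _ (g_cont z) (g_bdry z) t01 cp.
    - by rewrite eqxx.
    - by apply/orP; left; apply/orP; right; apply/asboolP.
    - apply/orP; right; apply/asboolP; exists t0, t1, v.
      by split=> //; rewrite ?t01'//; move: t01 => /andP[].
  by rewrite (leq_trans (leq_card_setU _ _))// leq_add2r leq_card_setU.
(* The cover at the end of the parametrisation of [z] determines [W], so each [z] contributes at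
   most one pair. *)
have b0 : (#|A0| <= #|Q|)%N.
  have inj : {in A0 &, injective fst}.
    move=> [z W] [z' W']; rewrite !inE /= => /andP[/and3P[zW _ _] /eqP c].
    move=> /andP[/and3P[zW' _ _] /eqP c'] e; subst z'.
    by congr pair; rewrite -(finset.setU1K zW) -(finset.setU1K zW') -c -c'.
  rewrite -(card_in_imset inj); apply: subset_leq_card; apply/fintype.subsetP.
  move=> _ /imsetP[[z W] + ->]; rewrite !inE /= => /andP[_ /eqP c].
  by have : z \in cover Q (g z 1) by [rewrite c finset.setU11]; move/coverP => [].
have VM S : S \subset Q -> (size (V S))%:R <= M.
  by move=> /VE[_ _]; apply: le_trans; rewrite ler_nat leq_addr.
have EM S : S \subset Q -> (size (E S))%:R <= M.
  by move=> /VE[_ _]; apply: le_trans; rewrite ler_nat leq_addl.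
(* [S] must contain [z] and [u] and avoid the rest of [W]: at most three objects are prescribed,
   whence 2^3. A vertex has [z |: W] as its cover, so there are at most three choices of [z], each
   fixing [W]. *)
have b1 : #|A1|%:R <= (2 ^ 3 * 3)%:R * M.
  apply: (@charging _ _ _ _ Q A1 V (fun x _ y => cover Q y == x.1 |: x.2)) => //.
    move=> [z W]; rewrite inE => /andP[]; rewrite inE /= => /and3P[zW /andP[_ W2] _].
    move=> /asboolP[t [u [t01 uW ct lim]]].
    have uQ : u \in Q /\ obj u (g z t) by apply/coverP; rewrite ct !inE uW orbT.
    have zQ : z \in Q /\ obj z (g z t) by apply/coverP; rewrite ct finset.setU11.
    exists ([set z; u])%SET, (W :\ u); split.
    - by rewrite finset.subUset !finset.sub1set zQ.1 uQ.1.
    - rewrite finset.disjoints_subset finset.subUset !finset.sub1set !inE eqxx.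
      by rewrite (negbTE zW) andbF.
    - rewrite -finset.setUA finset.setD1K// cardsU1 zW; lia.
    move=> S SQ; rewrite finset.subUset !finset.sub1set => /andP[zS uS] dS.
    exists (g z t); last by rewrite ct.
    (* Arbitrarily near [g z t] are boundary points of [z] where [u] is missing and which [S] covers
       by [z] alone. So [g z t] is on the boundary of the union and on that of [u]. *)
    have [Vsub _ _] := VE S SQ; apply: Vsub; split.
      apply: (bdry_union_limit _ z) => //; first exact: zQ.2.
      move=> B /lim[q [Bq zq sub uq]]; exists q; split=> // i iS iq.
      have iQ := fintype.subsetP SQ i iS.
      have /(fintype.subsetP sub)/setU1P[//|iW] : i \in cover Q q by apply/coverP.
      have [iu|iu] := eqVneq i u; first by move: uq => /negP[]; apply/coverP; rewrite -iu.
      by have := disjointFr dS iS; rewrite !inE iW iu.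
    exists z, u; split=> //; first by move=> e; rewrite e uW in zW.
      exact: g_bdry.
    apply: bdry_limit; first exact: uQ.2.
    move=> B /lim[q [Bq _ _ uq]]; exists q; split=> // uq'; move: uq => /negP[].
    by apply/coverP; split=> //; apply: uQ.1.
  move=> S y _ _.
  set X := ([set _ in _ | _])%SET; case: (set_0Vmem X) => [->|[x0 x0X]]; first by rewrite cards0.
  have inj : {in X &, injective fst}.
    move=> [z W] [z' W']; rewrite !inE /= => /andP[/andP[/and3P[zW _ _] _] /eqP c].
    move=> /andP[/andP[/and3P[zW' _ _] _] /eqP c'] e; subst z'.
    by congr pair; rewrite -(finset.setU1K zW) -(finset.setU1K zW') -c -c'.
  rewrite -(card_in_imset inj); apply: (@leq_trans #|cover Q y|).
    apply: subset_leq_card; apply/fintype.subsetP.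
    move=> _ /imsetP[[z W] zWX ->]; have -> : cover Q y = z |: W.
      by move: zWX; rewrite !inE => /andP[_ /eqP].
    by rewrite finset.setU11.
  have [h c0] : (0 < #|x0.2| <= 2)%N /\ cover Q y = x0.1 |: x0.2.
    by move: x0X; rewrite !inE => /andP[/andP[/and3P[_ -> _] _] /eqP].
  rewrite c0 cardsU1; move: h; case: (x0.1 \notin _); lia.
(* [S] must contain [z] and [v] and avoid [W]: at most four objects are prescribed, whence 2^4. The
   factor 1 is [edge_end_unique]. *)
have b2 : #|A2|%:R <= (2 ^ 4 * 1)%:R * M.
  apply: (@charging _ _ _ _ Q A2 E (fun x S y => `[< edge_end Q S y x.1 x.2 >])) => //.
    move=> [z W]; rewrite inE => /andP[]; rewrite inE /= => /and3P[zW /andP[_ W2] _].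
    move=> /asboolP[t0 [t1 [v [t00 /andP[t01 t11] vQ vzW [vt before]]]]].
    have zQ : z \in Q.
      have : z \in cover Q (g z t0) by rewrite before// finset.setU11.
      by move/coverP => [].
    have [vz vW] : v != z /\ v \notin W by move: vzW; rewrite !inE negb_or => /andP[].
    exists ([set z; v])%SET, W; split.
    - by rewrite finset.subUset !finset.sub1set zQ vQ.
    - by rewrite finset.disjoints_subset finset.subUset !finset.sub1set !inE zW vW.
    - apply: (leq_trans (leq_card_setU _ _)); rewrite cards2; lia.
    move=> S SQ; rewrite finset.subUset !finset.sub1set => /andP[zS vS] dS.
    have I t : t0 <= t -> t < t1 -> 0 <= t <= 1 by move=> *; apply/andP; split; lra.
    (* As [S] avoids [W], the traversed arc is covered in [S] by [z] alone. *)
    have only t i : t0 <= t -> t < t1 -> i \in S -> obj i (g z t) -> i = z.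
      move=> h1 h2 iS ig; have iQ := fintype.subsetP SQ i iS.
      have : i \in cover Q (g z t) by apply/coverP.
      by rewrite before// => /setU1P[//|iW]; have := disjointFr dS iS; rewrite iW.
    have arc t : t0 <= t -> t < t1 -> arcs_in S (g z t).
      move=> h1 h2; have zt := g_bdry z t (I t h1 h2); split.
        apply: (bdry_union_limit _ z) => //; first exact: bdry_sub.
        move=> B nB; exists (g z t); split=> //; first exact: nbhs_singleton nB.
        by move=> i; apply: only.
      move=> [_ [i [j [iS jS ij /bdry_sub ib /bdry_sub jb]]]]; apply: ij.
      by rewrite (only t i)// (only t j).
    have before_t1 B : nbhs (g z t1) B -> exists t, [/\ t0 <= t, t < t1 & B (g z t)].
      have I1 : 0 <= t1 <= 1 by apply/andP; split; lra.
      move=> /(curve_near _ _ _ _ _ (g_cont z) I1)[d d0 H].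
      pose t := Num.max t0 (t1 - d / 2).
      have h1 : t0 <= t by rewrite le_max lexx.
      have h2 : t < t1 by rewrite gt_max t01 /=; lra.
      have h3 : t1 - d < t by rewrite lt_max; apply/orP; right; lra.
      exists t; split=> //; apply: H; first exact: I.
      by rewrite gtr0_norm ?subr_gt0//; lra.
    have [_ Esub _] := VE S SQ.
    exists (connected_component (arcs_in S) (g z t0)); first by apply: Esub; apply: arc.
    apply/asboolP; split=> //; exists t0, t1; split=> //; first by rewrite t01.
      by move=> t h1 h2; split; [exact: before|exact: arc].
    have zt1 : bdry (obj z) (g z t1) by apply: g_bdry; apply/andP; split; lra.
    split.
      apply: (bdry_union_limit _ z) => //; first exact: bdry_sub.
      move=> B /before_t1[t [h1 h2 Bt]]; exists (g z t); split=> //.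
        by apply: g_bdry; apply: I.
      by move=> i; apply: only.
    exists z, v; split=> //; first by move=> e; rewrite e eqxx in vz.
    apply: bdry_limit => // B /before_t1[t [h1 h2 Bt]]; exists (g z t); split=> // vgt.
    by move: vz; rewrite (only t v)// eqxx.
  move=> S y _ _; rewrite (leqNgt _ 1); apply/negP => /card_gt1P[[z W] [[z' W'] []]].
  rewrite !inE /= => /andP[_ /asboolP e] /andP[_ /asboolP e'] /eqP; apply.
  by have [-> ->] := edge_end_unique _ _ _ _ _ _ _ e e'.
apply: (@le_trans _ _ (#|Q|%:R + #|A1|%:R + #|A2|%:R)).
  by rewrite -!natrD ler_nat; apply: leq_trans A012 _; rewrite !leq_add2r.
move: b1 b2; set x := _%:R * M; set y := _%:R * M => b1 b2.
(* The constant is 40 = 8 times 3 + 16 times 1. *)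
have -> : 40 * M = x + y by rewrite /x /y; ring.
lra.
Qed.


(** * From doubly covered points to boundary pairs *)

Context (obj_bounded : forall i, bounded_pt (obj i)).
Context (bdry_meet : forall i j, i <> j ->
  exists l : seq (pt R), bdry (obj i) `&` bdry (obj j) `<=` [set` l]).

(** The pairs are ordered because an insertion distinguishes the object inserted from the one it is
    joined to. *)
Definition double_pairs Q : {set T * T} :=
  ([set x : T * T | [&& x.1 \in Q, x.2 \in Q, x.1 != x.2 &
     `[< exists p, cover Q p = [set x.1; x.2]%SET >]]])%SET.

Lemma nbhs_box p (B : set (pt R)) : nbhs p B ->
  exists2 d, 0 < d & forall a b, `|p.1 - a| < d -> `|p.2 - b| < d -> B (a, b).
Proof. by move=> /nbhs_ballP[d d0 H]; exists d => // a b ha hb; apply: H; split. Qed.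

(** The values a + d/(k+2) are infinitely many distinct candidates, and a finite list cannot exclude
    them all. *)
Lemma generic_height (a d : R) (l : seq R) : 0 < d ->
  exists y, [/\ a < y, y < a + d & y \notin l].
Proof.
move=> d0; apply: contrapT => no.
pose h k := a + d / k.+2%:R.
have hP k : a < h k < a + d.
  have k0 : 0 < k.+2%:R :> R by rewrite ltr0n.
  rewrite ltrDl divr_gt0//= ltrD2l ltr_pdivrMr// ltr_pMr// ltr1n//.
have inj : injective h.
  move=> i j /addrI /(mulfI (lt0r_neq0 d0)) /invr_inj /eqP.
  by rewrite eqr_nat => /eqP[].
have : (size (map h (iota 0 (size l).+1)) <= size l)%N.
  apply: uniq_leq_size; first by rewrite map_inj_uniq// iota_uniq.
  move=> _ /mapP[k _ ->]; apply: contrapT => /negP kl; apply: no; exists (h k).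
  by have /andP[? ?] := hP k; split.
by rewrite size_map size_iota ltnn.
Qed.

(* The horizontal ray from a point of height [y] leaves the open region where
   the cover is [{u, w}] through the boundary of [u], of [w], or of an object
   that it enters. *)
Lemma ray_exit Q u w (x y : R) :
  u != w -> interior (obj u) (x, y) -> interior (obj w) (x, y) ->
  cover Q (x, y) = [set u; w]%SET ->
  [\/ (u, [set w]%SET) \in boundary_pairs Q, (w, [set u]%SET) \in boundary_pairs Q,
      exists z, (z, [set u; w]%SET) \in boundary_pairs Q |
      exists c i j, [/\ i <> j, bdry (obj i) (c, y) & bdry (obj j) (c, y)]].
Proof.
move=> uw ux wx cx.
have uwE a : interior (obj u) a -> interior (obj w) a -> cover Q a = [set u; w]%SET ->
    \forall b \near a, [/\ interior (obj u) b, interior (obj w) b & cover Q b = [set u; w]%SET].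
  move=> /nbhs_interior ua /nbhs_interior wa ca.
  have [uQ wQ] : u \in Q /\ w \in Q.
    by split; [have : u \in cover Q a by [rewrite ca !inE eqxx]
             | have : w \in cover Q a by [rewrite ca !inE eqxx orbT]]; move/coverP => [].
  apply: filterS3 ua wa (cover_near Q a) => b ub wb sub; split=> //.
  apply/eqP; rewrite finset.eqEsubset -{1}ca sub /= finset.subUset !finset.sub1set.
  by apply/andP; split; apply/coverP; split=> //; apply: interior_subset.
pose P (t : R) := [/\ interior (obj u) (t, y), interior (obj w) (t, y) &
  cover Q (t, y) = [set u; w]%SET].
have [M Mu] := obj_bounded u.
have xM : x <= M + 1.
  have [/= h _] := Mu _ (interior_subset ux); have := ler_norm x; lra.
have nPM : ~ P (M + 1).
  move=> [/interior_subset /Mu[/= h _] _ _]; have := ler_norm (M + 1); lra.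
have Px : P x by [].
have [c [xc cM before alt]] := @first_failure _ P _ _ xM Px nPM.
(* The region is open, so it cannot be left immediately after one of its points; hence [c] is
   already outside. *)
case: alt => [[[uc wc cc] near_c]|[ltc nPc]].
  have [d d0 H] := nbhs_box _ _ (uwE _ uc wc cc).
  have [t [ct tcd _ nt]] := near_c d d0; exfalso; apply: nt; apply: (H t y) => /=.
    by rewrite distrC gtr0_norm; lra.
  by rewrite subrr normr0.
have approach (B : set (pt R)) : nbhs (c, y) B -> exists2 t, P t & B (t, y).
  move=> /nbhs_box[d /= d0 H]; pose t := Num.max x (c - d / 2).
  have h1 : x <= t by rewrite le_max lexx.
  have h2 : t < c by rewrite gt_max ltc /=; lra.
  have h3 : c - d < t by rewrite lt_max; apply/orP; right; lra.
  exists t; first exact: before.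
  by apply: H; rewrite ?subrr ?normr0// gtr0_norm ?subr_gt0//; lra.
(* An object present at the exit but not just before it is entered through its boundary. *)
have into i : obj i (c, y) -> i \in Q -> i != u -> i != w -> bdry (obj i) (c, y).
  move=> ic iQ iu iw; apply: bdry_limit => // B /approach[t [_ _ ct] Bt].
  exists (t, y); split=> // it.
  have : i \in cover Q (t, y) by apply/coverP.
  by rewrite ct !inE (negbTE iu) (negbTE iw).
have [t0 [_ _ c0] /fintype.subsetP sub] := approach _ (cover_near Q (c, y)).
have uwc : u \in cover Q (c, y) /\ w \in cover Q (c, y).
  by split; apply: sub; rewrite c0 !inE eqxx ?orbT.
have [/coverP[uQ uc] /coverP[wQ wc]] := uwc.
(* With an unchanged cover, the ray must have left the interior of [u] or of [w]. Otherwise it has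
   entered one new object or at least two. *)
have [cc|ncc] := eqVneq (cover Q (c, y)) ([set u; w])%SET.
  have [iu|nu] := pselect (interior (obj u) (c, y)); last first.
    apply: Or41; rewrite inE /= inE uw cards1 /=; apply/asboolP; exists (c, y).
    by split=> //; split=> //; apply: subset_closure.
  have [iw|nw] := pselect (interior (obj w) (c, y)); first by case: nPc.
  apply: Or42; rewrite inE /= inE eq_sym uw cards1 /=; apply/asboolP; exists (c, y).
  by split; [split=> //; apply: subset_closure|rewrite cc finset.setUC].
have uwsub : [set u; w]%SET \subset cover Q (c, y).
  by rewrite finset.subUset !finset.sub1set uwc.1 uwc.2.
have /fintype.subsetPn[z zc] : ~~ (cover Q (c, y) \subset [set u; w]%SET).
  by apply: contraNN ncc => h; rewrite finset.eqEsubset h uwsub.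
rewrite !inE negb_or => /andP[zu zw]; have [zQ zc'] := coverP _ _ _ zc.
have bz := into z zc' zQ zu zw.
have [cz|/fintype.subsetPn[z' z'c]] := boolP (cover Q (c, y) \subset z |: [set u; w]%SET).
  apply: Or43; exists z; rewrite inE /= !inE negb_or zu zw cards2 uw /=.
  apply/asboolP; exists (c, y); split=> //; apply/eqP.
  by rewrite finset.eqEsubset cz /= finset.subUset finset.sub1set zc uwsub.
rewrite !inE !negb_or => /and3P[z'z z'u z'w]; have [z'Q z'c'] := coverP _ _ _ z'c.
by apply: Or44; exists c, z, z'; split; [move=> e; rewrite e eqxx in z'z|exact: bz|exact: into].
Qed.

(** If [p] is on the boundary of [u] or [w], it already gives a pair. Otherwise a small vertical
    shift keeps the cover and reaches a height free of boundary crossings, which rules out the last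
    outcome of [ray_exit]. *)
Lemma double_to_boundary Q u w p :
  u != w -> cover Q p = [set u; w]%SET ->
  [\/ (u, [set w]%SET) \in boundary_pairs Q, (w, [set u]%SET) \in boundary_pairs Q |
      exists z, (z, [set u; w]%SET) \in boundary_pairs Q].
Proof.
move=> uw cp.
have [/coverP[uQ up] /coverP[wQ wp]] : u \in cover Q p /\ w \in cover Q p.
  by rewrite cp !inE !eqxx orbT.
have [iu|nu] := pselect (interior (obj u) p); last first.
  apply: Or31; rewrite inE /= inE uw cards1 /=; apply/asboolP; exists p.
  by split=> //; split=> //; apply: subset_closure.
have [iw|nw] := pselect (interior (obj w) p); last first.
  apply: Or32; rewrite inE /= inE eq_sym uw cards1 /=; apply/asboolP; exists p.
  by split; [split=> //; apply: subset_closure|rewrite cp finset.setUC].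
have [d d0 H] := nbhs_box _ _
  (filterI (filterI (nbhs_interior iu) (nbhs_interior iw)) (cover_near Q p)).
have /choice[l lP] : forall x : T * T, exists l : seq (pt R), x.1 <> x.2 ->
    bdry (obj x.1) `&` bdry (obj x.2) `<=` [set` l].
  move=> x; have [->|/eqP ne] := eqVneq x.1 x.2; first by exists [::].
  by have [l lP] := bdry_meet _ _ ne; exists l.
have [y [py pyd yl]] := generic_height p.2 _
  (flatten [seq [seq q.2 | q <- l x] | x : T * T]) d0.
have [[/= iu' iw'] sub] : ((obj u)° `&` (obj w)° `&`
    (fun q => cover Q q \subset cover Q p)) (p.1, y).
  apply: H; first by rewrite subrr normr0.
  by rewrite distrC gtr0_norm; lra.
have cy : cover Q (p.1, y) = [set u; w]%SET.
  apply/eqP; rewrite finset.eqEsubset -{1}cp sub /= finset.subUset !finset.sub1set.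
  by apply/andP; split; apply/coverP; split=> //; apply: interior_subset.
have [h|h|h|[c [i [j [ij bi bj]]]]] := ray_exit _ _ _ _ _ uw iu' iw' cy.
- exact: Or31.
- exact: Or32.
- exact: Or33.
- exfalso; move: yl => /negP; apply; apply/flattenP.
  exists [seq q.2 | q <- l (i, j)]; first by apply/mapP; exists (i, j); rewrite ?mem_enum.
  apply/mapP; exists (c, y) => //.
  exact: (lP (i, j) ij (c, y) (conj bi bj)).
Qed.

Lemma double_pairs_card Q : (#|double_pairs Q| <= 2 * #|boundary_pairs Q|)%N.
Proof.
(* [phi] recovers the unordered pair from the boundary pair it was sent to; the factor 2 accounts
   for its two orderings. *)
pose phi (x : T * {set T}) := if #|x.2| == 1%N then x.1 |: x.2 else x.2.
have hit x : x \in double_pairs Q -> exists2 y, y \in boundary_pairs Q &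
    [set x.1; x.2]%SET == phi y.
  rewrite inE => /and4P[_ _ ne /asboolP[p cp]].
  have [h|h|[z h]] := double_to_boundary _ _ _ _ ne cp.
  - by exists (x.1, [set x.2]%SET) => //; rewrite /phi cards1 eqxx.
  - by exists (x.2, [set x.1]%SET) => //; rewrite /phi cards1 eqxx finset.setUC.
  - by exists (z, [set x.1; x.2]%SET) => //; rewrite /phi cards2 ne.
apply: (@leq_trans (\sum_(x in double_pairs Q) \sum_(y in boundary_pairs Q)
    ([set x.1; x.2]%SET == phi y))%N).
  rewrite -sum1_card; apply: leq_sum => x /hit[y yA e].
  by rewrite (bigD1 y)//= e.
rewrite exchange_big mulnC -sum_nat_const; apply: leq_sum => y _.
pose X := ([set x in double_pairs Q | [set x.1; x.2]%SET == phi y])%SET.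
have -> : (\sum_(x in double_pairs Q) ([set x.1; x.2]%SET == phi y) = #|X|)%N.
  rewrite -sum1_card big_mkcond [RHS]big_mkcond; apply: eq_bigr => x _.
  by rewrite [in RHS]inE; case: (x \in _); case: eqP.
have [->|[x0 x0X]] := set_0Vmem X; first by rewrite cards0.
have XP x : x \in X -> x.1 != x.2 /\ [set x.1; x.2]%SET = phi y.
  by rewrite inE => /andP[]; rewrite inE => /and4P[_ _ ? _] /eqP.
have inj : {in X &, injective fst}.
  move=> [a b] [a' b'] /XP[/= ab e] /XP[/= ab' e'] aa'; subst a'; congr pair.
  have : b \in [set a; b']%SET by rewrite e' -e !inE eqxx orbT.
  by rewrite !inE eq_sym (negbTE ab) => /eqP.
rewrite -(card_in_imset inj); have [_ e0] := XP _ x0X.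
apply: (@leq_trans #|phi y|); last by rewrite -e0 cards2; case: (_ != _).
apply: subset_leq_card; apply/fintype.subsetP => _ /imsetP[x /XP[_ e] ->].
by rewrite -e !inE eqxx.
Qed.

End Arrangement.

(** * Using the union complexity bound *)

Lemma union_complexity_sub (R : realType) (T : finType) (obj : T -> set (pt R))
    (S : {set T}) (k : R) :
  union_complexity_le (fun i : {x : T | x \in S} => obj (val i)) k ->
  exists (V : seq (pt R)) (E : seq (set (pt R))),
    [/\ vertex_in obj S `<=` [set` V],
        forall p, arcs_in obj S p -> connected_component (arcs_in obj S) p \in E &
        (size V + size E)%:R <= k].
Proof.
set obj' := fun i : {x : T | x \in S} => obj (val i).
have eU : union_of obj' = union_in obj S.
  apply/seteqP; split=> p; first by move=> [i ip]; exists (val i) => //; apply: (valP i).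
  by move=> [i iS ip]; exists (exist _ i iS).
have eV : union_vertices obj' = vertex_in obj S.
  rewrite /union_vertices eU; apply/seteqP; split=> p [bp [i [j]]].
    move=> [ij [ip jp]]; split=> //; exists (val i), (val j).
    by split=> //; [exact: (valP i)|exact: (valP j)|move=> /val_inj].
  move=> [iS jS ij ip jp]; split=> //; exists (exist _ i iS), (exist _ j jS).
  by split=> // -[].
move=> [V [E [_ [_ [VE [EE kVE]]]]]]; exists V, E; split=> //.
  by rewrite -eV VE.
move=> p Xp; suff : [set` E] (connected_component (arcs_in obj S) p) by [].
by rewrite -EE /union_edges eU eV; exists p.
Qed.

(** The boundary of a single region is a nonempty curve without vertices, so it contributes at least
    one edge. *)
Lemma union_complexity_ge1 (R : realType) (A : set (pt R)) (k : R) :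
  jordan_region A -> union_complexity_le (fun _ : unit => A) k -> 1 <= k.
Proof.
move=> [_ [_ [g [_ [_ [_ gE]]]]]] [V [E [_ [_ [_ [EE kVE]]]]]].
have eU : union_of (fun _ : unit => A) = A.
  by apply/seteqP; split=> p; [move=> []|exists tt].
have b0 : bdry A (g 0) by rewrite gE; exists 0 => //=; rewrite in_itv /= lexx ler01.
have nv : ~ union_vertices (fun _ : unit => A) (g 0) by move=> [_ [[] [[] []]]].
have : [set` E] (connected_component
    (bdry (union_of (fun _ : unit => A)) `\` union_vertices (fun _ : unit => A)) (g 0)).
  by rewrite -EE; exists (g 0) => //; split=> //; rewrite eU.
move=> /=; case: E kVE {EE} => // e E kVE _; apply: le_trans kVE.
by rewrite ler1n addnS.
Qed.

(** The constant is 82 = 2 times (1 + 40), with [#|Q|] absorbed into [M]. *)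
Lemma double_pairs_bound (R : realType) (T : finType) (obj : T -> set (pt R))
    (Q : {set T}) (M : R) :
  (forall i, jordan_region (obj i)) ->
  (forall i j, i <> j ->
     exists l : seq (pt R), bdry (obj i) `&` bdry (obj j) `<=` [set` l]) ->
  (forall S : {set T}, S \subset Q -> S != finset.set0 ->
     union_complexity_le (fun i : {x : T | x \in S} => obj (val i)) M) ->
  #|Q|%:R <= M ->
  #|double_pairs obj Q|%:R <= 82 * M.
Proof.
move=> jr meet cplx QM.
have M0 : 0 <= M by apply: le_trans QM.
have cl i : closed (obj i) by have [] := jr i.
have bd i : bounded_pt (obj i) by have [_ []] := jr i.
have /choice[g gP] i : exists g : R -> pt R, [/\ {within `[0, 1], continuous g},
    g 0 = g 1, {in `[0, 1[ &, injective g} & bdry (obj i) = g @` `[0, 1]].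
  by have [_ [_ [g [? [? [? ?]]]]]] := jr i; exists g.
have [gc gl gi ge] : [/\ forall z, {within `[0, 1], continuous (g z)},
    forall z, g z 0 = g z 1, forall z, {in `[0, 1[ &, injective (g z)} &
    forall z, bdry (obj z) = g z @` `[0, 1]].
  by split=> z; have [] := gP z.
have bp : #|boundary_pairs obj Q|%:R <= #|Q|%:R + 40 * M.
  apply: (boundary_pairs_bound _ cl g) => // S SQ.
  (* The complexity hypothesis covers nonempty families; the empty one has no vertices and no
     edges. *)
  have [->|S0] := eqVneq S finset.set0; last exact: union_complexity_sub (cplx S SQ S0).
  exists [::], [::]; split=> // [p [_ [i [j []]]]|p /(arcs_in_bdry _ cl)[i]]; by rewrite inE.
have : #|double_pairs obj Q|%:R <= (2 * #|boundary_pairs obj Q|)%:R :> R.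
  by rewrite ler_nat; apply: double_pairs_card.
rewrite natrM; lra.
Qed.

(** * Hubs and the spanner *)

(** [S] is the set of objects inserted so far. A hub of a point is joined to all other objects
    there, inserted or not; the construction takes the first inserted one. *)
Definition hub_edges {R : realType} {T : finType} (obj : T -> set (pt R))
    (S : {set T}) (D : {set T * T}) : Prop :=
  (forall x, x \in D -> igraph obj x.1 x.2) /\
  (forall p i, i \in S -> obj i p ->
     exists w, obj w p /\ forall u, obj u p -> u != w -> (w, u) \in D).

(** Points covered by [S] keep their hubs, and [w] becomes the hub of its remaining points. No
    object of [S] contains such a point, so new edges only go to later objects. *)
Lemma hub_edges_add (R : realType) (T : finType) (obj : T -> set (pt R))
    (S : {set T}) (D : {set T * T}) (w : T) :
  hub_edges obj S D -> w \notin S ->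
  exists D', hub_edges obj (w |: S) D' /\
    (#|D'| <= #|D| + #|[set u | (u \notin w |: S) &&
       `[< exists p, [/\ obj w p, obj u p & forall i, i \in S -> ~ obj i p] >]]%SET|)%N.
Proof.
move=> [DG Dhub] wS; set N := ([set u | _])%SET.
exists (D :|: [set (w, u) | u in N]%SET); split; last first.
  by apply: leq_trans (leq_card_setU _ _) _; rewrite leq_add2l leq_imset_card.
split=> [x|p i].
  rewrite inE => /orP[/DG//|/imsetP[u]]; rewrite !inE negb_or.
  move=> /andP[/andP[uw _] /asboolP[p [wp up _]]] -> /=; split; last by exists p.
  by move=> e; rewrite e eqxx in uw.
move=> iS ip; have [[j jS jp]|noS] := pselect (exists2 j, j \in S & obj j p).
  have [v [vp vD]] := Dhub p j jS jp; exists v; split=> // u up uv.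
  by rewrite inE vD.
have wp : obj w p.
  by move: iS => /setU1P[<-//|iS]; case: noS; exists i.
exists w; split=> // u up uw; rewrite inE; apply/orP; right; apply: imset_f.
rewrite !inE negb_or uw /=; apply/andP; split.
  by apply/negP => uS; apply: noS; exists u.
by apply/asboolP; exists p; split=> // j jS jp; apply: noS; exists j.
Qed.

(** The hub of a common point of [u] and [v] is equal or joined to each of them. *)
Lemma hub_edges_spanner (R : realType) (T : finType) (obj : T -> set (pt R))
    (D : {set T * T}) :
  hub_edges obj finset.setT D ->
  exists H : rel T, t_hop_spanner (igraph obj) H 2 /\ (nedges H <= #|D|)%N.
Proof.
move=> [DG Dhub]; exists (fun u v => ((u, v) \in D) || ((v, u) \in D)).
have sym u v : igraph obj u v -> igraph obj v u.
  by move=> [uv [p [up vp]]]; split; [move=> e; apply: uv|exists p].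
split; first (split; [|split]).
- by move=> u v; rewrite orbC.
- by move=> u v /orP[/DG//|/DG/sym].
- move=> u v [uv [p [up vp]]].
  have [w [wp wD]] := Dhub p u (finset.in_setT u) up.
  have [uw|uw] := eqVneq u w; first subst w.
    by exists [:: v]; split=> //=; rewrite wD//; apply/eqP => e; apply: uv.
  have [vw|vw] := eqVneq v w; first subst w.
    by exists [:: v]; split=> //=; rewrite wD ?orbT.
  by exists [:: w; v]; split=> //=; rewrite !wD ?orbT.
(* Edges are counted as unordered pairs, so symmetrising [D] does not increase the count. *)
rewrite /nedges; apply: (@leq_trans #|[set ([set x.1; x.2])%SET | x in D]%SET|);
  last exact: leq_imset_card.
apply: subset_leq_card; apply/fintype.subsetP => x /imsetP[[a b]].
rewrite inE /= => /orP[h|h] ->; apply/imsetP; first by exists (a, b).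
by exists (b, a) => //=; rewrite finset.setUC.
Qed.

Theorem theorem17 (R : realType) (s : nat) (F : set (set (pt R))) (U : nat -> R) :
  well_behaved s F ->
  (forall (T : finType) (obj : T -> set (pt R)),
      injective obj -> (forall i, F (obj i)) -> (0 < #|T|)%N ->
      union_complexity_le obj (U #|T|)) ->
  (forall m n : nat, (0 < m)%N -> (m <= n)%N -> U m / m%:R <= U n / n%:R) ->
  exists (C : R) (N : nat), 0 < C /\
    forall (T : finType) (obj : T -> set (pt R)),
      injective obj -> (forall i, F (obj i)) -> (N <= #|T|)%N ->
      exists H : rel T, t_hop_spanner (igraph obj) H 2 /\
        (nedges H)%:R <= C * U #|T| * ln (#|T|%:R).
Proof.
(* 246 is 82 from [double_pairs_bound] times 3 from [harmonic_le_ln], which requires [n] to be at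
   least 2. *)
move=> [jr meet] cplx ratio; exists 246, 2%N; split; first lra.
move=> T obj inj Fobj n2; set n := #|T|.
have [i0 _] : exists i0 : T, True.
  by have /card_gt0P[i0 _] : (0 < #|T|)%N by [exact: ltnW]; exists i0.
have U1 : 1 <= U 1%N.
  apply: (union_complexity_ge1 _ _ _ (jr _ (Fobj i0))); rewrite -card_unit.
  by apply: cplx => [[] []|_|] //; rewrite card_unit.
(* Since the ratio is nondecreasing and at least 1 at 1, [U] dominates the identity. *)
have Uge m : (0 < m)%N -> m%:R <= U m.
  move=> m0; have := ratio 1%N m isT m0; rewrite divr1 => h.
  by have := le_trans U1 h; rewrite ler_pdivlMr ?ltr0n// mul1r.
have n0 : 0 < n%:R :> R by rewrite ltr0n; apply: ltnW.
pose b := 82 * (U n / n%:R).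
have Un0 : 0 <= U n by apply: le_trans (Uge n (ltnW n2)).
have b0 : 0 <= b by rewrite mulr_ge0 ?divr_ge0.
have Umono m m' : (0 < m)%N -> (m <= m')%N -> U m <= U m'.
  move=> m0 mm'; have := ratio m m' m0 mm'.
  have m'0 : (0 < m')%N by apply: leq_trans mm'.
  rewrite ler_pdivrMr ?ltr0n// => h; apply: le_trans h _.
  rewrite -mulrA ler_piMr//; first by apply: le_trans (Uge m' m'0).
  by rewrite mulrC ler_pdivrMr ?ltr0n// mul1r ler_nat.
(* The nondecreasing ratio turns the bound 82 U(|Q|) into one linear in |Q|, with the same slope [b]
   for all [Q]. *)
have few (Q : {set T}) : #|double_pairs obj Q|%:R <= b * #|Q|%:R.
  have [->|Q0] := eqVneq Q finset.set0.
    rewrite cards0 mulr0 (_ : #|_| = 0%N)//; apply/eqP; rewrite cards_eq0.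
    by apply/eqP/finset.setP => x; rewrite !inE.
  rewrite -card_gt0 in Q0.
  have mQ : (#|Q| <= n)%N by apply: max_card.
  apply: (@le_trans _ _ (82 * U #|Q|)); last first.
    rewrite /b -mulrA; apply: ler_wpM2l => //.
    by have := ratio _ _ Q0 mQ; rewrite ler_pdivrMr ?ltr0n.
  apply: double_pairs_bound => [i|i j ij|S SQ S0|].
  - exact: jr (Fobj i).
  - have [|l [_ lP]] := meet _ _ (Fobj i) (Fobj j); last by exists l.
    by move=> /inj.
  - have Sgt0 : (0 < #|S|)%N by rewrite card_gt0.
    have cS : #|{: {x : T | x \in S}}| = #|S| by rewrite card_sig; apply: eq_card.
    have injS : injective (fun i : {x : T | x \in S} => obj (val i)).
      by move=> i j /inj /val_inj.
    have S0' : (0 < #|{: {x : T | x \in S}}|)%N by rewrite cS.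
    have [V [E [uV [uE [VE [EE VEU]]]]]] := cplx _ _ injS (fun i => Fobj (val i)) S0'.
    exists V, E; split=> //; split=> //; split=> //; split=> //.
    by apply: le_trans VEU _; rewrite cS; apply: Umono => //; apply: subset_leq_card.
  - exact: Uge.
pose hit (S : {set T}) w u :=
  `[< exists p, [/\ obj w p, obj u p & forall i, i \in S -> ~ obj i p] >].
have pairs (Q : {set T}) :
    (\sum_(u in Q) \sum_(w in Q :\ u) hit (Q :\ u :\ w) w u)%:R <= b * #|Q|%:R.
  (* A hit relative to [Q] without [u] and [w] is a point whose cover in [Q] is exactly these
     two. *)
  apply: le_trans (few Q); rewrite ler_nat pair_big_dep /= -sum1_card.
  rewrite big_mkcond [leqRHS]big_mkcond; apply: leq_sum => -[u w] _ /=.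
  case: ifP => // /andP[uQ]; rewrite !inE => /andP[wu wQ].
  have [/asboolP[p [wp up only]]|//] := boolP (hit (Q :\ u :\ w) w u).
  rewrite uQ wQ eq_sym wu /= asboolT//; exists p; apply/finset.setP => i; rewrite !inE.
  apply/andP/orP => [[iQ /asboolP ip]|[/eqP ->|/eqP ->]]; last 2 first.
  - by split=> //; apply/asboolP.
  - by split=> //; apply/asboolP.
  apply/orP; apply: contraT; rewrite negb_or => /andP[iu iw].
  by case: (only i) => //; rewrite !inE iu iw.
have hubs0 : exists D, hub_edges obj finset.set0 D /\ (#|D| <= 0)%N.
  by exists finset.set0; rewrite cards0; split=> //; split=> [x|p i]; rewrite inE.
have hubsS (S : {set T}) k w : (exists D, hub_edges obj S D /\ (#|D| <= k)%N) ->
    w \notin S -> exists D, hub_edges obj (w |: S) D /\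
      (#|D| <= k + #|[set u | (u \notin w |: S) && hit S w u]%SET|)%N.
  move=> [D [hD Dk]] wS; have [D' [hD' D'k]] := hub_edges_add _ _ _ _ _ _ hD wS.
  by exists D'; split=> //; apply: leq_trans D'k _; rewrite leq_add2r.
have [k [[D [hD Dk]] kle]] := @greedy_average R T
  (fun S k => exists D, hub_edges obj S D /\ (#|D| <= k)%N) hit b b0 hubs0 hubsS pairs.
have [H [spanH HD]] := hub_edges_spanner _ _ _ _ hD.
exists H; split=> //; apply: (@le_trans _ _ k%:R).
  by rewrite ler_nat; apply: leq_trans Dk.
apply: le_trans kle _.
have -> : b * #|T|%:R = 82 * U n by rewrite /b -mulrA divfK// gt_eqF.
rewrite (_ : 246 * U n * ln n%:R = 82 * U n * (3 * ln n%:R)); last by ring.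
by apply: ler_wpM2l; [rewrite mulr_ge0|apply: harmonic_le_ln].
Qed.
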